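(* Let $N=\{1,2,\dots,p\}$, $M=N\cup\{p+1\}$, $\mathbb{R}^n=\prod_{\nu\in N}\mathbb{R}^{n_\nu}$ with a norm $\|\cdot\|$; for each $\nu\in N$ let $K_\nu\subset\mathbb{R}^{n_\nu}$, $K=\prod_{\nu\in N}K_\nu$, let $X_\nu:K\rightrightarrows\mathbb{R}^{n_\nu}$ be a set-valued map and $\theta_\nu:\mathbb{R}^n\to\mathbb{R}$ a function. Define $$\hat{K}_\nu=\begin{cases}\mathrm{co}(K_\nu\cup X_\nu(K)),&\nu\in N,\\ K,&\nu=p+1,\end{cases}\qquad \hat{K}=\prod_{\nu\in M}\hat{K}_\nu,$$ and, writing $\mathbf{x}=(\mathbf{x}_0,\mathbf{x}^{p+1})$ with $\mathbf{x}_0=(\mathbf{x}^\nu)_{\nu\in N}$, define $\hat{X}_\nu:\hat{K}\rightrightarrows\hat{K}_\nu$ and $\hat{\theta}_\nu:\mathbb{R}^n\times\mathbb{R}^n\to\mathbb{R}$ by $$\hat{X}_\nu(\mathbf{x})=\begin{cases}X_\nu(\mathbf{x}^{p+1}),&\nu\in N,\\ K,&\nu=p+1,\end{cases}\qquad \hat{\theta}_\nu(\mathbf{x})=\begin{cases}\theta_\nu(\mathbf{x}_0),&\nu\in N,\\ \|\mathbf{x}_0-\mathbf{x}^{p+1}\|,&\nu=p+1.\end{cases}$$ Then the following implications hold: 1. If $\hat{\mathbf{x}}\in\mathrm{GNEP}(\{\hat{\theta}_\nu,\hat{X}_\nu\}_{\nu\in M})$, then $\hat{\mathbf{x}}^{p+1}\in\mathrm{PSGNEP}(\{\theta_\nu,X_\nu\}_{\nu\in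 N})$. 2. If $\hat{x}\in\mathrm{PSGNEP}(\{\theta_\nu,X_\nu\}_{\nu\in N})$, then there exists $\hat{y}\in\mathbb{R}^n$ such that the vector $\hat{\mathbf{x}}=(\hat{y},\hat{x})\in\mathrm{GNEP}(\{\hat{\theta}_\nu,\hat{X}_\nu\}_{\nu\in M})$.
   Context: Notation: a vector indexed by a player set is written $x=(x^\nu,x^{-\nu})$, where $x^\nu$ is the component of player $\nu$ and $x^{-\nu}$ collects the components of the other players. $\mathrm{co}(A)$ is the convex hull of $A$, and $X_\nu(K)=\bigcup_{x\in K}X_\nu(x)$. The component $\mathbf{x}^{p+1}$ lies in $K\subset\mathbb{R}^n$ and $\mathbf{x}_0=\mathbf{x}^{-(p+1)}\in\mathbb{R}^n$. Generalized Nash equilibria: $\mathrm{GNEP}(\{\hat{\theta}_\nu,\hat{X}_\nu\}_{\nu\in M})$ is the set of $\hat{\mathbf{x}}\in\hat{K}$ such that for each $\nu\in M$, $\hat{\mathbf{x}}^\nu\in\hat{X}_\nu(\hat{\mathbf{x}})$ and $\hat{\theta}_\nu(\hat{\mathbf{x}})\le\hat{\theta}_\nu(z^\nu,\hat{\mathbf{x}}^{-\nu})$ for all $z^\nu\in\hat{X}_\nu(\hat{\mathbf{x}})$. Projected solutions: $\mathrm{PSGNEP}(\{\theta_\nu,X_\nu\}_{\nu\in N})$ is the set of $\hat{x}\in K$ for which there exists $\hat{y}\in\prod_{\nu\in N}X_\nu(\hat{x})$ such that (i) $\hat{x}$ is a projection of $\hat{y}$ onto $K$, i.e. $\|\hat{y}-\hat{x}\|\le\|\hat{y}-x\|$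 for all $x\in K$; and (ii) for each $\nu\in N$, $\theta_\nu(\hat{y})\le\theta_\nu(w^\nu,\hat{y}^{-\nu})$ for all $w^\nu\in X_\nu(\hat{x})$. *)

(* Defs.v *)
From HB Require Import structures.
From mathcomp Require Import all_boot all_order all_algebra.
From mathcomp Require Import all_classical reals convex.

Set Implicit Arguments.
Unset Strict Implicit.
Unset Printing Implicit Defensive.

Import Order.TTheory GRing.Theory Num.Theory.
Local Open Scope classical_set_scope.
Local Open Scope ring_scope.

(** The space R^n = \prod_nu R^(n_nu), as a vector space with pointwise
    operations; the library has no such instance on dependent products. *)

Definition rVprod (R : realType) (p : nat) (n : 'I_p -> nat) : Type :=
  forall nu : 'I_p, 'rV[R]_(n nu).

Section RVprod.
Variables (R : realType) (p : nat) (n : 'I_p -> nat).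
Local Notation E := (rVprod R n).
Implicit Types (x y z : E) (a b : R).

HB.instance Definition _ := gen_eqMixin E.
HB.instance Definition _ := gen_choiceMixin E.

Definition rVprod_zero : E := fun nu => 0.
Definition rVprod_opp x : E := fun nu => - x nu.
Definition rVprod_add x y : E := fun nu => x nu + y nu.
Definition rVprod_scale a x : E := fun nu => a *: x nu.

Fact rVprod_addA : associative rVprod_add.
Proof. by move=> x y z; apply: functional_extensionality_dep => nu; apply: addrA. Qed.
Fact rVprod_addC : commutative rVprod_add.
Proof. by move=> x y; apply: functional_extensionality_dep => nu; apply: addrC. Qed.
Fact rVprod_add0 : left_id rVprod_zero rVprod_add.
Proof. by move=> x; apply: functional_extensionality_dep => nu; apply: add0r. Qed.
Fact rVprod_addN : left_inverse rVprod_zero rVprod_opp rVprod_add.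
Proof. by move=> x; apply: functional_extensionality_dep => nu; apply: addNr. Qed.

HB.instance Definition _ := GRing.isZmodule.Build E
  rVprod_addA rVprod_addC rVprod_add0 rVprod_addN.

Fact rVprod_scaleA a b x :
  rVprod_scale a (rVprod_scale b x) = rVprod_scale (a * b) x.
Proof. by apply: functional_extensionality_dep => nu; apply: scalerA. Qed.
Fact rVprod_scale1 : left_id 1 rVprod_scale.
Proof. by move=> x; apply: functional_extensionality_dep => nu; apply: scale1r. Qed.
Fact rVprod_scaleDr : right_distributive rVprod_scale +%R.
Proof. by move=> a x y; apply: functional_extensionality_dep => nu; apply: scalerDr. Qed.
Fact rVprod_scaleDl x : {morph rVprod_scale^~ x : a b / a + b}.
Proof. by move=> a b; apply: functional_extensionality_dep => nu; apply: scalerDl. Qed.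

HB.instance Definition _ := GRing.Zmodule_isLmodule.Build R E
  rVprod_scaleA rVprod_scale1 rVprod_scaleDr rVprod_scaleDl.

End RVprod.

(** An arbitrary norm on a real vector space, as opposed to the one fixed by
    a [normedModType] instance. *)
Record is_norm (R : realType) (E : lmodType R) (N : E -> R) : Prop := IsNorm {
  is_norm_triangle : forall x y, N (x + y) <= N x + N y ;
  is_norm_homo : forall a x, N (a *: x) = `|a| * N x ;
  is_norm_eq0 : forall x, N x = 0 -> x = 0 }.

Definition convex_hull (R : realType) (E : lmodType R) (A : set E) : set E :=
  smallest (@convex_set R E) A.

Definition cartesian (I : Type) (V : I -> Type) (K : forall i, set (V i)) :
    set (forall i, V i) :=
  [set x | forall i, K i (x i)].

(** Generalized Nash equilibria. [X i] is only ever used on [cartesian K].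
    [dfwith x i z] is the profile (z^i, x^{-i}). *)
Definition GNEP (R : realType) (I : eqType) (V : I -> Type)
    (K : forall i, set (V i))
    (theta : I -> (forall i, V i) -> R)
    (X : forall i, (forall j, V j) -> set (V i)) : set (forall i, V i) :=
  [set x | cartesian K x /\
    forall i, X i x (x i) /\
      forall z : V i, X i x z -> theta i x <= theta i (dfwith x i z)].

Section ProjectedSolutions.
Variables (R : realType) (p : nat) (n : 'I_p -> nat).
Local Notation E := (rVprod R n).
Variables (N : E -> R) (K : forall nu : 'I_p, set 'rV[R]_(n nu)).
Variables (theta : 'I_p -> E -> R) (X : forall nu, E -> set 'rV[R]_(n nu)).
Arguments K : clear implicits.
Arguments X : clear implicits.

Definition is_projection (A : set E) (y x : E) : Prop :=
  A x /\ forall z, A z -> N (y - x) <= N (y - z).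

Definition PSGNEP : set E :=
  [set x | cartesian K x /\
    exists y : E,
      [/\ forall nu, X nu x (y nu),
          is_projection (cartesian K) y x
        & forall nu (w : 'rV[R]_(n nu)), X nu x w ->
            theta nu y <= theta nu (dfwith y nu w)]].

(** The extended game: the players are [option 'I_p], where [Some nu] is the
    original player nu and [None] is the additional player p + 1. *)

Definition hatV (i : option 'I_p) : Type :=
  if i is Some nu then 'rV[R]_(n nu) else E.

Definition hatprofile (y x : E) : forall i, hatV i :=
  fun i => if i is Some nu then y nu else x.

Definition hat0 (x : forall i, hatV i) : E := fun nu => x (Some nu).

Definition hatlast (x : forall i, hatV i) : E := x None.

Definition hatK (i : option 'I_p) : set (hatV i) :=
  match i with
  | Some nu => convex_hull (K nu `|` \bigcup_(x in cartesian K) X nu x)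
  | None => cartesian K
  end.

Definition hatX (i : option 'I_p) (x : forall j, hatV j) : set (hatV i) :=
  match i with
  | Some nu => X nu (hatlast x)
  | None => cartesian K
  end.

Definition hattheta (i : option 'I_p) (x : forall j, hatV j) : R :=
  match i with
  | Some nu => theta nu (hat0 x)
  | None => N (hat0 x - hatlast x)
  end.

Arguments hatK i _ : clear implicits.
Arguments hatX i x _ : clear implicits.

Lemma hatX_sub_hatK i x : cartesian hatK x -> hatX i x `<=` hatK i.
Proof.
case: i => [nu|] Kx z Xz //= A [_ sub]; apply: sub; right.
by exists (hatlast x) => //; exact: (Kx None).
Qed.

End ProjectedSolutions.

Arguments hatK {R p n} K X i _.
Arguments hatX {R p n} K X i x _.

(* Main.v *)
Require Import Defs.
From mathcomp Require Import all_boot all_order all_algebra.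
From mathcomp Require Import all_classical reals.

(** The added player chooses freely in [cartesian K] and pays the distance to the profile of the
    others, so its best responses are exactly the projections of that profile onto [cartesian K]. An
    original player's constraint set depends only on the added player's point, and its cost only on
    the original players' profile. Hence the equilibrium conditions, player by player, are those of
    a projected solution with [y] equal to [hat0 x]; the [dfwith] lemmas match the deviations. *)

Section UnilateralDeviation.
Variables (R : realType) (p : nat) (n : 'I_p -> nat).
Implicit Types x : forall i, hatV R n i.

Lemma hat0_dfwith_Some x (nu : 'I_p) (w : 'rV[R]_(n nu)) :
  hat0 (dfwith x (Some nu) w) = dfwith (hat0 x) nu w.
Proof.
apply: functional_extensionality_dep => mu; rewrite /hat0.
have [->|nu_mu] := eqVneq mu nu; first by rewrite !dfwithin.
by rewrite !dfwithout // eq_sym.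
Qed.

Lemma hat0_dfwith_None x (z : rVprod R n) :
  hat0 (dfwith x None z) = hat0 x.
Proof. by apply: functional_extensionality_dep => mu; apply: dfwithout. Qed.

Lemma hatlast_dfwith_None x (z : rVprod R n) :
  hatlast (dfwith x None z) = z.
Proof. exact: (@dfwithin _ (hatV R n) x None z). Qed.

End UnilateralDeviation.

Theorem proposition3p8 (R : realType) (p : nat) (n : 'I_p -> nat)
    (N : rVprod R n -> R) (hN : is_norm N)
    (K : forall nu : 'I_p, set 'rV[R]_(n nu))
    (X : forall nu : 'I_p, rVprod R n -> set 'rV[R]_(n nu))
    (theta : 'I_p -> rVprod R n -> R) :
  (forall x : forall i, hatV R n i,
      GNEP (hatK K X) (hattheta N theta) (hatX K X) x ->
      PSGNEP N K theta X (hatlast x)) /\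
  (forall x : rVprod R n,
      PSGNEP N K theta X x ->
      exists y : rVprod R n,
        GNEP (hatK K X) (hattheta N theta) (hatX K X) (hatprofile y x)).
Proof.
split=> [x [Kx eq_x] | x [Kx [y [Xy [_ proj_y] opt_y]]]].
  split; first exact: (Kx None).
  exists (hat0 x); split.
  - by move=> nu; exact: (eq_x (Some nu)).1.
  - split; first exact: (Kx None).
    (* Optimality of the added player against the deviation [z] is the projection inequality. *)
    move=> z Kz; have /= := (eq_x None).2 z Kz.
    by rewrite hat0_dfwith_None hatlast_dfwith_None.
  - move=> nu w Xw; have /= := (eq_x (Some nu)).2 w Xw.
    by rewrite hat0_dfwith_Some.
exists y; split.
  case=> [nu|]; last exact: Kx.
  (* Since [x] lies in [cartesian K], [y nu] belongs to the union of the values of [X nu], hence to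
     every convex set containing it. *)
  by move=> A [_ sub]; apply: sub; right; exists x => //; exact: Xy.
case=> [nu|]; split.
- exact: Xy.
(* [hat0 (hatprofile y x)] is convertible to [y]. *)
- by move=> w Xw /=; rewrite hat0_dfwith_Some; exact: opt_y.
- exact: Kx.
- move=> z Kz /=; rewrite hat0_dfwith_None hatlast_dfwith_None.
  exact: proj_y.
Qed.
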